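(* Let $A$ be a unital locally $C^*$-algebra such that $b(\mathcal{H}_A)=\mathcal{H}_{b(A)}$ and let $E$ be a Hilbert $A$-module. If $E$ is countably generated (as a Hilbert $A$-module), then $b(E)$ is countably generated (as a Hilbert $b(A)$-module).
   Context: A locally $C^*$-algebra is a complete Hausdorff complex topological $*$-algebra $A$ whose topology is determined by its continuous $C^*$-seminorms: a net $(a_i)$ converges to $0$ iff $p(a_i)\to 0$ for every continuous $C^*$-seminorm $p$. $S(A)$ denotes the set of all continuous $C^*$-seminorms on $A$. The set of bounded elements $b(A)=\{a\in A: \|a\|_\infty=\sup_{p\in S(A)}p(a)<\infty\}$ is a $C^*$-algebra with norm $\|\cdot\|_\infty$. A pre-Hilbert $A$-module is a complex vector space $E$ that is also a right $A$-module (compatible with the complex algebra structure), with an $A$-valued inner product $\langle\cdot,\cdot\rangle:E\times E\to A$ that is $\mathbb{C}$- and $A$-linear in the second variable and satisfies $\langle\xi,\eta\rangle^*=\langle\eta,\xi\rangle$, $\langle\xi,\xi\rangle\ge 0$, and $\langle\xi,\xi\rangle=0$ iff $\xi=0$. It is a Hilbert $A$-module if it is complete for the topology given by the seminorms $\overline{p}_E(\xi)=\sqrt{p(\langle\xi,\xi\rangle)}$, $p\in S(A)$. The set of bounded elements $b(E)=\{\xi\in E:\|\xi\|_\infty=\sup_{p\in S(A)}\overline{p}_E(\xi)<\infty\}$ is a Hilbert $C^*$-module over $b(A)$. $\mathcal{H}_A=\{(a_n)_{n\ge 1}: a_n\in A,\ \sum_{n=1}^\infty a_n^*a_n \text{ converges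 in } A\}$, a Hilbert $A$-module with componentwise operations and $\langle (a_n)_n,(b_n)_n\rangle=\sum_n a_n^*b_n$. $\mathcal{H}_{b(A)}$ is the analogous module for the $C^*$-algebra $b(A)$ (convergence of $\sum a_n^*a_n$ in $\|\cdot\|_\infty$); it is a closed submodule of $b(\mathcal{H}_A)=\{(a_n)_n:\sum_n a_n^*a_n\text{ converges in }A\text{ to an element of }b(A)\}$, in general a proper one. A subset $G$ of a Hilbert module $E$ is a generating set if the closed submodule of $E$ generated by $G$ is all of $E$; $E$ is countably generated if it has a countable generating set. *)

(* Defs.v *)
From HB Require Import structures.
From mathcomp Require Import all_boot all_order all_algebra.
From mathcomp Require Import complex.
From mathcomp Require Import all_classical all_reals topology normedtype.
From mathcomp Require Import tvs sequences.

Set Implicit Arguments.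
Unset Strict Implicit.
Unset Printing Implicit Defensive.

Import Order.TTheory GRing.Theory Num.Theory.
Import numFieldNormedType.Exports.

Local Open Scope classical_set_scope.
Local Open Scope ring_scope.
Local Open Scope complex_scope.

(* The unit of A is part of [algType]; as usual for the library's algebras it
   is nonzero, which only leaves out the zero algebra. *)
HB.mixin Record isStarAlgebra (R : realType) A & GRing.Algebra R[i] A := {
  star : A -> A;
  starK : involutive star;
  starD : {morph star : a b / a + b};
  starZ : forall (c : R[i]) (a : A), star (c *: a) = c^*%C *: star a;
  starM : forall a b : A, star (a * b) = star b * star a
}.

#[short(type="starAlgType")]
HB.structure Definition StarAlgebra (R : realType) :=
  {A of GRing.Algebra R[i] A & isStarAlgebra R A}.

Record cstar_seminorm (R : realType) (A : starAlgType R) (p : A -> R) : Prop :=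
  CstarSeminorm {
    csn_ge0 : forall a, 0 <= p a;
    csnD : forall a b, p (a + b) <= p a + p b;
    csnZ : forall (c : R[i]) a, p (c *: a) = complex.Re `|c| * p a;
    csnM : forall a b, p (a * b) <= p a * p b;
    csn_star : forall a, p (star a * a) = p a ^+ 2
  }.

HB.mixin Record isTopStarAlgebra (R : realType) A
    & StarAlgebra R A & Topological A := {
  mul_continuous : continuous (fun x : A * A => x.1 * x.2);
  star_continuous : continuous (star : A -> A)
}.

#[short(type="topStarAlgType")]
HB.structure Definition TopStarAlgebra (R : realType) :=
  {A of StarAlgebra R A & TopologicalLmodule R[i] A & isTopStarAlgebra R A}.

Definition cstar_seminorms (R : realType) (A : topStarAlgType R)
    : set (A -> R) :=
  [set p | cstar_seminorm p /\ continuous p].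

(* Completeness is that of the underlying topological vector space, i.e. for
   the translation-invariant uniformity; filters stand for nets. *)
HB.mixin Record isLocallyCstar (R : realType) A & TopStarAlgebra R A := {
  lc_hausdorff : hausdorff_space A;
  lc_complete : forall F : set_system A, ProperFilter F ->
    x.1 - x.2 @[x --> filter_prod F F] --> (0 : A) ->
    exists l : A, F --> l;
  lc_topology : forall F : set_system A, ProperFilter F ->
    F --> (0 : A) <->
    (forall p : A -> R, cstar_seminorms p -> p a @[a --> F] --> (0 : R))
}.

#[short(type="locallyCstarType")]
HB.structure Definition LocallyCstar (R : realType) :=
  {A of TopStarAlgebra R A & isLocallyCstar R A}.

(* Not the library's order: a >= 0 means that a = b^* b for some b. *)
Definition positive (R : realType) (A : starAlgType R) (a : A) : Prop :=
  exists b : A, a = star b * b.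

Section SeminormFamilies.
Context {R : realType} {V : zmodType}.
Implicit Types (P : set (V -> R)) (F : set_system V).

Definition sn_cvg P F (l : V) : Prop :=
  forall p, P p -> p (x - l) @[x --> F] --> (0 : R).

Definition sn_cauchy P F : Prop :=
  forall p, P p -> p (x.1 - x.2) @[x --> filter_prod F F] --> (0 : R).

Definition sn_complete P : Prop :=
  forall F, ProperFilter F -> sn_cauchy P F -> exists l, sn_cvg P F l.

Definition sn_bounded P : set V :=
  [set x | has_ubound [set p x | p in P]].

(* [sup] is only meaningful on [sn_bounded P]; it is used nowhere else. *)
Definition sn_sup P (x : V) : R := sup [set p x | p in P].

End SeminormFamilies.

HB.mixin Record isPreHilbertModule (R : realType) (A : locallyCstarType R) E
    & GRing.Lmodule R[i] E := {
  ract : E -> A -> E;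
  ractDl : forall (x y : E) (a : A), ract (x + y) a = ract x a + ract y a;
  ractDr : forall (x : E) (a b : A), ract x (a + b) = ract x a + ract x b;
  ractM : forall (x : E) (a b : A), ract x (a * b) = ract (ract x a) b;
  ractZl : forall (c : R[i]) (x : E) (a : A), ract (c *: x) a = c *: ract x a;
  ractZr : forall (c : R[i]) (x : E) (a : A), ract x (c *: a) = c *: ract x a;
  ract1 : forall x : E, ract x 1 = x;
  inner : E -> E -> A;
  innerDr : forall x y z : E, inner x (y + z) = inner x y + inner x z;
  innerZr : forall (c : R[i]) (x y : E), inner x (c *: y) = c *: inner x y;
  innerAr : forall (x y : E) (a : A), inner x (ract y a) = inner x y * a;
  star_inner : forall x y : E, star (inner x y) = inner y x;
  inner_ge0 : forall x : E, positive (inner x x);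
  inner_eq0 : forall x : E, inner x x = 0 <-> x = 0
}.

#[short(type="preHilbertModType")]
HB.structure Definition PreHilbertModule (R : realType)
    (A : locallyCstarType R) :=
  {E of GRing.Lmodule R[i] E & isPreHilbertModule R A E}.

Definition module_seminorms (R : realType) (A : locallyCstarType R)
    (E : preHilbertModType A) : set (E -> R) :=
  [set (fun x : E => Num.sqrt (p (inner x x)))
     | p in @cstar_seminorms R A].

HB.mixin Record isHilbertModule (R : realType) (A : locallyCstarType R) E
    & PreHilbertModule R A E := {
  hilbert_complete : sn_complete (@module_seminorms R A E)
}.

#[short(type="hilbertModType")]
HB.structure Definition HilbertModule (R : realType)
    (A : locallyCstarType R) :=
  {E of PreHilbertModule R A E & isHilbertModule R A E}.

Section BoundedElements.
Context {R : realType} (A : locallyCstarType R).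

Definition bA : set A := sn_bounded (@cstar_seminorms R A).

Definition bA_norm : A -> R := sn_sup (@cstar_seminorms R A).

Definition bE (E : hilbertModType A) : set E :=
  sn_bounded (@module_seminorms R A E).

Definition bE_norm (E : hilbertModType A) : E -> R :=
  sn_sup (@module_seminorms R A E).

Definition square_sums (a : nat -> A) : nat -> A :=
  [series star (a n) * a n]_n.

(* [b_standard_module] is b(H_A): the sum converges in A, with bounded limit.
   [standard_module_b] is H_{b(A)}: the sum converges in norm in b(A). *)
Definition b_standard_module : set (nat -> A) :=
  [set a | exists2 l : A, bA l & square_sums a @ \oo --> l].

Definition standard_module_b : set (nat -> A) :=
  [set a | (forall n, bA (a n)) /\
     exists2 l : A, bA l & sn_cvg [set bA_norm] (square_sums a @ \oo) l].

End BoundedElements.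
Arguments bA {R} A.
Arguments bA_norm {R} A.
Arguments b_standard_module {R} A.
Arguments standard_module_b {R} A.
Arguments bE {R A} E.
Arguments bE_norm {R A} E.

(* A Hilbert module over a subalgebra B of A, carried by a subset V of E and
   topologized by the family P, is encoded by the triple (B, V, P): this covers
   both E over A and b(E) over b(A).  Closedness is relative to V and is
   expressed through limits of filters (nets) of elements of M. *)
Section Generation.
Context {R : realType} {A : locallyCstarType R} {E : preHilbertModType A}.
Variables (B : set A) (V : set E) (P : set (E -> R)).

Record closed_submodule (M : set E) : Prop := ClosedSubmodule {
  csub_sub : M `<=` V;
  csub0 : M 0;
  csubD : forall x y, M x -> M y -> M (x + y);
  csubZ : forall (c : R[i]) x, M x -> M (c *: x);
  csubA : forall x a, M x -> B a -> M (ract x a);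
  csub_closed : forall F : set_system E, ProperFilter F -> F M ->
    forall x, V x -> sn_cvg P F x -> M x
}.

Definition generating_set (G : set E) : Prop :=
  G `<=` V /\ smallest closed_submodule G = V.

Definition countably_generated : Prop :=
  exists G : set E, countable G /\ generating_set G.

End Generation.

Definition hilbert_countably_generated (R : realType)
    (A : locallyCstarType R) (E : hilbertModType A) : Prop :=
  countably_generated [set: A] [set: E] (@module_seminorms R A E).

Definition bE_countably_generated (R : realType)
    (A : locallyCstarType R) (E : hilbertModType A) : Prop :=
  countably_generated (bA A) (bE E) [set bE_norm E].

(* Main.v *)
(* Put R_0 = 1 and R_{n+1} = R_n - theta_n, where theta_n x = xi_n <xi_n, x>,
   xi_n = R_n eta_n, and (eta_n) is a sequence with <eta_n, eta_n> <= 1 that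
   takes each of its values infinitely often.  Then 0 <= R_n <= 1, and for a
   fixed value eta the elements c_n = <eta, R_n eta> decrease, with
   c_{n+1} = c_n - c_n^2 whenever eta_n = eta; hence c_n <= 1/k after k - 1
   visits.  If the eta_n generate E, it follows that <x, R_n x> -> 0 for all x,
   i.e. <x, x> = sum_n a_n^* a_n with a_n = <xi_n, x>.  When x is bounded,
   (a_n) lies in b(H_A), hence in H_{b(A)}, so that <x, R_n x> -> 0 uniformly in
   the seminorms; thus x = sum_n xi_n a_n in b(E), which is generated by the xi_n.
   A generator g is replaced by eta = g (1 + <g, g>)^{-1} to make it bounded.

   The order on A is handled one C*-seminorm p at a time, without spectra:
   h >= 0 at p means that h is self-adjoint and p(s - h) <= s for some s >= 0. *)
Require Import Defs.
From mathcomp Require Import all_boot all_order all_algebra.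
From mathcomp Require Import complex.
From mathcomp Require Import all_classical all_reals.
From mathcomp Require Import topology normedtype tvs sequences.
From mathcomp Require Import ring lra.
From Stdlib Require Ncring_tac.

Set Implicit Arguments.
Unset Strict Implicit.
Unset Printing Implicit Defensive.

Import Order.TTheory GRing.Theory Num.Theory.
Import numFieldNormedType.Exports.

Local Open Scope classical_set_scope.
Local Open Scope ring_scope.
Local Open Scope complex_scope.

(** * Identities in non-commutative rings *)

#[local] Instance nzRing_ops (A : nzRingType) :
  @Ncring.Ring_ops A 0 1 +%R *%R (fun x y => x - y) -%R eq := {}.
#[local] Instance nzRing_ring (A : nzRingType) : Ncring.Ring (Ro := nzRing_ops A).
Proof.
split; rewrite /Algebra_syntax.equality /Ncring.eq_notation.
- exact: RelationClasses.eq_equivalence.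
all: try by repeat move=> ?; subst.
- exact: add0r.
- exact: addrC.
- exact: addrA.
- exact: mul1r.
- exact: mulr1.
- exact: mulrA.
- exact: mulrDl.
- move=> *; exact: mulrDr.
- exact: subrr.
Qed.

Ltac ncring := rewrite ?expr2; Ncring_tac.non_commutative_ring.

(** * Real scalars and approximate square roots *)

Section StarAlgebraScalars.
Context {R : realType} {A : starAlgType R}.
Implicit Types (a b : A) (s t : R).

(** Real multiples are written as products with these central self-adjoint elements, so that
    [ncring] can treat them as atoms. *)
Definition sc (t : R) : A := (t%:C)%:A.

Lemma scD s t : sc (s + t) = sc s + sc t.
Proof. by rewrite /sc rmorphD /= scalerDl. Qed.

Lemma scM s t : sc (s * t) = sc s * sc t.
Proof. by rewrite /sc rmorphM /= -scalerAl mul1r scalerA. Qed.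

Lemma sc0 : sc 0 = 0.
Proof. by rewrite /sc rmorph0 scale0r. Qed.

Lemma sc1 : sc 1 = 1.
Proof. by rewrite /sc rmorph1 scale1r. Qed.

Lemma scN t : sc (- t) = - sc t.
Proof. by rewrite /sc rmorphN /= scaleNr. Qed.

Lemma scB s t : sc (s - t) = sc s - sc t.
Proof. by rewrite scD scN. Qed.

Lemma scC t a : sc t * a = a * sc t.
Proof. by rewrite /sc -scalerAl -scalerAr mul1r mulr1. Qed.

Lemma comm_sc t a : GRing.comm a (sc t).
Proof. by rewrite /GRing.comm scC. Qed.

Lemma scE t a : sc t * a = t%:C *: a.
Proof. by rewrite /sc -scalerAl mul1r. Qed.

Lemma scVK t a : t != 0 -> sc t * (sc t^-1 * a) = a.
Proof. by move=> t0; rewrite mulrA -scM divff// sc1 mul1r. Qed.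

Lemma scKV t a : t != 0 -> sc t^-1 * (sc t * a) = a.
Proof. by move=> t0; rewrite mulrA -scM mulVf// sc1 mul1r. Qed.

Lemma sc2 a : sc 2 * a = a + a.
Proof. by rewrite -[2]/(1 + 1) scD sc1 mulrDl mul1r. Qed.

Lemma star1 : star 1 = 1 :> A.
Proof. by have := starM 1 (star (1 : A)); rewrite !mul1r starK mul1r. Qed.

Lemma star_sc t : star (sc t) = sc t.
Proof.
rewrite /sc starZ star1; congr (_ *: _).
by rewrite /= oppr0.
Qed.

Lemma star_scM t a : star (sc t * a) = sc t * star a.
Proof. by rewrite starM star_sc scC. Qed.

Lemma star0 : star 0 = 0 :> A.
Proof. by have := star_sc 0; rewrite sc0. Qed.

Lemma starN a : star (- a) = - star a.
Proof. by rewrite -[- a]mul1r mulrN -mulNr -sc1 -scN star_scM scN sc1 mulNr mul1r. Qed.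

Lemma starB a b : star (a - b) = star a - star b.
Proof. by rewrite starD starN. Qed.

End StarAlgebraScalars.

Section CstarSeminorm.
Context {R : realType} {A : starAlgType R} {p : A -> R}.
Hypothesis hp : cstar_seminorm p.
Implicit Types (a b h k x y : A) (s t e : R).

Lemma sn_scM t a : p (sc t * a) = `|t| * p a.
Proof. by rewrite scE (csnZ hp) normc_def /= expr0n /= addr0 sqrtr_sqr. Qed.

Lemma sn_ge0 a : 0 <= p a. Proof. exact: csn_ge0. Qed.

Lemma sn0 : p 0 = 0.
Proof. by rewrite -(mul0r 0) -sc0 sn_scM normr0 mul0r. Qed.

Lemma snN a : p (- a) = p a.
Proof. by rewrite -[- a]mul1r mulrN -mulNr -sc1 -scN sn_scM normrN1 mul1r. Qed.

Lemma snB a b : p (a - b) <= p a + p b.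
Proof. by rewrite -(snN b); exact: csnD. Qed.

Lemma sn_distC a b : p (a - b) = p (b - a).
Proof. by rewrite -opprB snN. Qed.

Lemma sn_near a b : p a <= p b + p (a - b).
Proof. by rewrite -{1}(subrK b a) addrC; exact: csnD. Qed.

Lemma sn_star a : p (star a) = p a.
Proof.
have H c : p c <= p (star c).
  have [->|c0] := eqVneq (p c) 0; first exact: sn_ge0.
  have c_gt0 : 0 < p c by rewrite lt0r c0 sn_ge0.
  by rewrite -(ler_pM2r c_gt0) -expr2 -(csn_star hp) (csnM hp).
by apply/eqP; rewrite eq_le H -{2}(starK a) H.
Qed.

Lemma sn_sq h : star h = h -> p (h * h) = p h ^+ 2.
Proof. by move=> hh; rewrite -{1}hh (csn_star hp). Qed.

(** By the C*-identity [p 1] is its own square, hence 1, or 0 when p vanishes identically. *)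
Lemma sn1 : p 1 <= 1.
Proof.
have /eqP := sn_sq star1; rewrite mulr1 expr2 -{1}[p 1]mulr1.
have [->//|p0] := eqVneq (p 1) 0.
by rewrite (inj_eq (mulfI p0)) => /eqP <-.
Qed.

Lemma sn_sc t : p (sc t) <= `|t|.
Proof. by rewrite -[sc t]mulr1 sn_scM ler_piMr// sn1. Qed.

Lemma sn_sc_ge0 t : 0 <= t -> p (sc t) <= t.
Proof. by move=> t0; rewrite -{2}(ger0_norm t0) sn_sc. Qed.

(** A fixed point w of this recursion satisfies (1 - w)^2 = 1 - x. The iterates are polynomials in
    x, so they commute with whatever commutes with x. *)
Fixpoint sqrt_iter x n : A :=
  if n is n'.+1 then sc 2^-1 * (x + sqrt_iter x n' * sqrt_iter x n') else 0.

Lemma star_sqrt_iter x n : star x = x -> star (sqrt_iter x n) = sqrt_iter x n.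
Proof.
move=> xx; elim: n => [|n IH] /=; first exact: star0.
by rewrite star_scM starD starM xx IH.
Qed.

Lemma comm_sqrt_iter x y n : GRing.comm y x -> GRing.comm y (sqrt_iter x n).
Proof.
move=> yx; elim: n => [|n IH] /=; first by rewrite /GRing.comm mulr0 mul0r.
apply: commrM; first exact: comm_sc.
by apply: commrD => //; exact: commrM.
Qed.

(** The bound reproduces itself: ((1 - d^2) + (1 - d)^2) / 2 = 1 - d. *)
Lemma sn_sqrt_iter x (d : R) n : 0 <= d <= 1 -> p x <= 1 - d ^+ 2 ->
  p (sqrt_iter x n) <= 1 - d.
Proof.
move=> /andP[d0 d1] px; elim: n => [|n IH] /=; first by rewrite sn0 subr_ge0.
rewrite sn_scM ger0_norm ?invr_ge0// mulrC ler_pdivrMr//.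
have := csnD hp x (sqrt_iter x n * sqrt_iter x n).
have := csnM hp (sqrt_iter x n) (sqrt_iter x n).
have := sn_ge0 (sqrt_iter x n).
nra.
Qed.

(** Since u^2 - v^2 = u (u - v) + (u - v) v with u and v of seminorm at most 1 - d, each step
    shrinks the difference by the factor 1 - d. *)
Lemma sn_sqrt_iterS x (d : R) n : 0 <= d <= 1 -> p x <= 1 - d ^+ 2 ->
  p (sqrt_iter x n.+1 - sqrt_iter x n) <= (1 - d) ^+ n.
Proof.
move=> d01 px; elim: n => [|n IH].
  rewrite expr0 /= mulr0 addr0 subr0 sn_scM ger0_norm ?invr_ge0// mulrC ler_pdivrMr//.
  by have := sqr_ge0 d; lra.
set u := sqrt_iter x n.+1; set v := sqrt_iter x n in IH *.
have -> : sqrt_iter x n.+2 - u = sc 2^-1 * (u * (u - v) + (u - v) * v).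
  transitivity (sc 2^-1 * (x + u * u) - sc 2^-1 * (x + v * v)); first by [].
  by clearbody u v; move: (sc 2^-1) => a; ncring.
rewrite sn_scM ger0_norm ?invr_ge0// mulrC ler_pdivrMr//.
have pu : p u <= 1 - d by exact: sn_sqrt_iter.
have pv : p v <= 1 - d by exact: sn_sqrt_iter.
have := csnD hp (u * (u - v)) ((u - v) * v).
have := csnM hp u (u - v).
have := csnM hp (u - v) v.
rewrite exprS.
have h1 : p u * p (u - v) <= (1 - d) * (1 - d) ^+ n by apply: ler_pM => //; exact: sn_ge0.
have h2 : p (u - v) * p v <= (1 - d) * (1 - d) ^+ n.
  by rewrite mulrC; apply: ler_pM => //; exact: sn_ge0.
lra.
Qed.

Lemma expr_small (q e : R) : 0 <= q < 1 -> 0 < e -> exists n, q ^+ n < e.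
Proof.
move=> /andP[q0 q1] e0.
have : (fun n => q ^+ n) @ \oo --> (0 : R) by apply: cvg_expr; rewrite ger0_norm.
move=> /cvgr0Pnorm_lt /(_ _ e0) [n _ /(_ n (leqnn n))] /=.
by rewrite normrX ger0_norm//; exists n.
Qed.

(* With w' = (x + w^2) / 2 the error (1 - w)^2 - (1 - x) equals 2 (w' - w). *)
Lemma sqrt_approx x e : star x = x -> p x < 1 -> 0 < e ->
  exists s : A, [/\ star s = s, forall y, GRing.comm y x -> GRing.comm y s,
    p (1 - s) <= 1 & p (s * s - (1 - x)) <= e].
Proof.
move=> xx px e0; set d := Num.sqrt (1 - p x).
have dE : d ^+ 2 = 1 - p x by rewrite sqr_sqrtr// subr_ge0 ltW.
have d0 : 0 < d by rewrite sqrtr_gt0 subr_gt0.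
have d1 : d <= 1.
  rewrite -(@ler_pXn2r _ 2) ?nnegrE ?ler01 ?(ltW d0)// dE expr1n.
  by rewrite lerBlDr lerDl sn_ge0.
have d01 : 0 <= d <= 1 by rewrite (ltW d0).
have px' : p x <= 1 - d ^+ 2 by rewrite dE; lra.
have [||n hn] := @expr_small (1 - d) (e / 2); [lra|lra|].
pose w := sqrt_iter x n; exists (1 - w); split.
- by rewrite starB star1 star_sqrt_iter.
- move=> y yx; apply: commrB; first exact: commr1.
  exact: comm_sqrt_iter.
- rewrite opprB addrC subrK; have := @sn_sqrt_iter x d n d01 px'; rewrite -/w; lra.
- have -> : (1 - w) * (1 - w) - (1 - x) = sc 2 * (sqrt_iter x n.+1 - w).
    by rewrite /= -/w [sc 2 * _]mulrBr scVK ?pnatr_eq0// sc2; ncring.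
  have := @sn_sqrt_iterS x d n d01 px'; rewrite -/w sn_scM ger0_norm//.
  lra.
Qed.

(* z + i q is, up to scaling, a unitary. *)
Lemma sn_unitary z q : star z = z -> star q = q -> GRing.comm z q ->
  p z ^+ 2 <= p (z * z + q * q).
Proof.
move=> zz qq zq; pose u := z + 'i%C *: q.
have su : star u = z - 'i%C *: q.
  rewrite /u starD starZ zz qq -scaleNr; congr (_ + _ *: _).
  by apply/eqP; rewrite eq_complex /= oppr0 !eqxx.
have <- : star u * u = z * z + q * q.
  rewrite su /u mulrBl !mulrDr -!scalerAl -!scalerAr zq scalerA -(expr2 'i%C) sqr_i.
  by rewrite scaleN1r; ncring.
rewrite (csn_star hp) ler_pXn2r ?nnegrE ?sn_ge0//.
have zE : z = sc 2^-1 * (u + star u).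
  by rewrite su /u addrACA subrr addr0 -sc2 scKV ?pnatr_eq0.
rewrite {1}zE sn_scM ger0_norm ?invr_ge0// mulrC ler_pdivrMr//.
have := csnD hp u (star u); rewrite sn_star; lra.
Qed.
End CstarSeminorm.

(** * Positivity with respect to a C*-seminorm *)

(** The norm criterion for positivity in the C*-algebra that p induces, except that self-adjointness
    is asked in A itself and not only modulo the kernel of p. *)
Definition sn_pos {R : realType} {A : starAlgType R} (p : A -> R) (h : A) :=
  star h = h /\ exists2 s : R, 0 <= s & p (sc s - h) <= s.

(** Passage to the limit for estimates with an error e; the restriction e <= 1 lets terms in e^2 be
    absorbed into [C * e]. *)
Lemma le_of_le_addM {R : realType} (C a b : R) :
  (forall e, 0 < e -> e <= 1 -> a <= b + C * e) -> a <= b.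
Proof.
move=> H; rewrite leNgt; apply/negP => ab.
pose d := (a - b) / (2 * (`|C| + 1)).
have C0 : 0 <= `|C| by [].
have d0 : 0 < d by rewrite divr_gt0 ?subr_gt0//; lra.
have dE : d * (`|C| + 1) = (a - b) / 2 by rewrite /d; field; lra.
have C1 : C <= `|C| := ler_norm C.
have [d1|d1] := leP d 1; first by have := H d d0 d1; nra.
have := H 1 ltr01 (lexx 1); nra.
Qed.

Section PositiveElements.
Context {R : realType} {A : starAlgType R} {p : A -> R}.
Hypothesis hp : cstar_seminorm p.
Implicit Types (a b h k m x y : A) (s t e : R).

Lemma sn_pos_star h : sn_pos p h -> star h = h. Proof. by case. Qed.

Lemma sn_posD h k : sn_pos p h -> sn_pos p k -> sn_pos p (h + k).
Proof.
move=> [hh [s s0 hs]] [kk [t t0 kt]]; split; first by rewrite starD hh kk.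
exists (s + t); first exact: addr_ge0.
have -> : sc (s + t) - (h + k) = (sc s - h) + (sc t - k) by rewrite scD; ncring.
by apply: (le_trans (csnD hp _ _)); exact: lerD.
Qed.

Lemma sn_posZ t h : 0 <= t -> sn_pos p h -> sn_pos p (sc t * h).
Proof.
move=> t0 [hh [s s0 hs]]; split; first by rewrite star_scM hh.
exists (t * s); first exact: mulr_ge0.
by rewrite scM -mulrBr (sn_scM hp) ger0_norm// ler_wpM2l.
Qed.

Lemma sn_pos_sc t : 0 <= t -> sn_pos p (sc t).
Proof.
by move=> t0; split; [exact: star_sc|exists t => //; rewrite subrr (sn0 hp)].
Qed.

(** Put x = k^2 / t, q = k / sqrt t and r ~ sqrt (1 - x), which commutes with q. Then r^2 + q^2 ~ 1,
    so [sn_unitary] bounds p(r)^2 by about 1, and 1 - x ~ r^2. *)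
Lemma sn_sc_sub_sq k t : star k = k -> p k ^+ 2 <= t -> p (sc t - k * k) <= t.
Proof.
move=> kk pk; apply: (@le_of_le_addM _ 4) => e e0 e1.
have t_ge0 : 0 <= t by apply: le_trans pk; exact: sqr_ge0.
(* The enlarged t' is positive and gives the strict bound p x < 1 that [sqrt_approx] requires. *)
pose t' := t + e; have t'0 : 0 < t' by rewrite /t'; lra.
have t'n0 : t' != 0 by rewrite gt_eqF.
pose x := sc t'^-1 * (k * k).
have xx : star x = x by rewrite star_scM starM kk.
have px : p x < 1.
  rewrite (sn_scM hp) (sn_sq hp kk) ger0_norm ?invr_ge0 ?ltW// mulrC.
  by rewrite ltr_pdivrMr// mul1r /t'; lra.
have et : 0 < e / t' by exact: divr_gt0.
have [r [rr rx _ hr]] := sqrt_approx hp xx px et.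
pose q := sc (Num.sqrt t')^-1 * k.
have qq : q * q = x.
  rewrite /q -mulrA (mulrA k) -(scC _ k) -mulrA mulrA -scM -invfM -expr2.
  by rewrite sqr_sqrtr ?ltW.
have qs : star q = q by rewrite star_scM kk.
have rq : GRing.comm r q.
  apply/commr_sym/rx; apply: commrM; first exact: comm_sc.
  apply/commr_sym/commrM; first exact: comm_sc.
  by rewrite /GRing.comm mulrA.
have := sn_unitary hp rr qs rq; rewrite qq -(sn_sq hp rr) => pr.
have prx : p (r * r + x) <= 1 + e / t'.
  have -> : r * r + x = 1 + (r * r - (1 - x)) by ncring.
  apply: (le_trans (csnD hp _ _)); have := sn1 hp; lra.
have pt' : p (sc t' - k * k) <= t' + 2 * e.
  have -> : sc t' - k * k = sc t' * (1 - x) by rewrite mulrBr mulr1 scVK.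
  rewrite (sn_scM hp) gtr0_norm//.
  have := sn_near hp (1 - x) (r * r); rewrite (sn_distC hp) => H.
  have H2 : p (1 - x) <= 1 + 2 * (e / t') by lra.
  apply: (@le_trans _ _ (t' * (1 + 2 * (e / t')))); first by rewrite ler_pM2l.
  by rewrite mulrDr mulr1 mulrCA [t' * _]mulrC divfK.
have -> : sc t - k * k = (sc t' - k * k) - sc e by rewrite /t' scD; ncring.
apply: (le_trans (snB hp _ _)); have := sn_sc_ge0 hp (ltW e0).
by rewrite /t' in pt' *; lra.
Qed.

Lemma sn_pos_sq k : star k = k -> sn_pos p (k * k).
Proof.
move=> kk; split; first by rewrite starM kk.
by exists (p k ^+ 2); [exact: sqr_ge0|exact: sn_sc_sub_sq].
Qed.

(** With d = e/2 and k = 1 - (h + d) / (s + d), the bound p(s - h) <= s becomes p k < 1, and m is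
    sqrt (s + d) times an approximate root of 1 - k. One half of e pays for the shift, the other for
    the root. *)
Lemma sn_pos_sqrt h e : sn_pos p h -> 0 < e -> exists m : A,
  [/\ sn_pos p m, forall y, GRing.comm y h -> GRing.comm y m &
      p (m * m - h) <= e].
Proof.
move=> [hh [s s0 hs]] e0; pose d := e / 2; have d0 : 0 < d by exact: divr_gt0.
pose s' := s + d; have s'0 : 0 < s' by rewrite /s'; lra.
have s'n0 : s' != 0 by rewrite gt_eqF.
pose k := 1 - sc s'^-1 * (h + sc d).
have kE : sc s' * (1 - k) = h + sc d by rewrite /k opprB addrC subrK scVK.
have kk : star k = k by rewrite starB star1 star_scM starD hh star_sc.
have pk : p k < 1.
  have : p (sc s' * k) <= s.
    have -> : sc s' * k = sc s' - sc s' * (1 - k) by ncring.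
    by rewrite kE /s' scD (_ : _ - _ = sc s - h)//; ncring.
  rewrite (sn_scM hp) gtr0_norm// => H.
  by rewrite -(ltr_pM2l s'0) mulr1; apply: (le_lt_trans H); rewrite /s' ltrDl.
have es : 0 < d / s' by exact: divr_gt0.
have [r [rr rk r1 hr]] := sqrt_approx hp kk pk es.
exists (sc (Num.sqrt s') * r); split.
- apply: sn_posZ; first exact: sqrtr_ge0.
  by split=> //; exists 1; rewrite ?sc1.
- move=> y yh; apply: commrM; first exact: comm_sc.
  apply: rk; apply: commrB; first exact: commr1.
  apply: commrM; first exact: comm_sc.
  by apply: commrD => //; rewrite /GRing.comm scC.
- have -> : sc (Num.sqrt s') * r * (sc (Num.sqrt s') * r) - h =
      sc s' * (r * r - (1 - k)) + sc d.
    rewrite mulrBr kE -mulrA (mulrA r) -(scC _ r) -mulrA mulrA -scM -expr2.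
    by rewrite sqr_sqrtr ?ltW//; ncring.
  apply: (le_trans (csnD hp _ _)); rewrite (sn_scM hp) gtr0_norm//.
  have := sn_sc_ge0 hp (ltW d0).
  move: hr; rewrite -(ler_pM2l s'0) mulrCA divff// mulr1 /d; lra.
Qed.

(** Any t >= p h can serve as the witness in [sn_pos]: h is close to a square m^2, to which
    [sn_sc_sub_sq] applies. *)
Lemma sn_pos_sub h t : sn_pos p h -> p h <= t -> p (sc t - h) <= t.
Proof.
move=> hpos ht; apply: (@le_of_le_addM _ 3) => e e0 e1.
have [m [/sn_pos_star mm _ hm]] := sn_pos_sqrt hpos e0.
have pm : p m ^+ 2 <= t + e.
  by rewrite -(sn_sq hp mm); have := sn_near hp (m * m) h; lra.
have := sn_sc_sub_sq mm pm.
have -> : sc t - h = (sc (t + e) - m * m) + (m * m - h) - sc e by rewrite scD; ncring.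
have := snB hp ((sc (t + e) - m * m) + (m * m - h)) (sc e).
have := csnD hp (sc (t + e) - m * m) (m * m - h).
have := sn_sc_ge0 hp (ltW e0); lra.
Qed.

(* With [z = x - t/2], [x (t - x) = t^2/4 - z^2] is close to a square [q^2], so
   that [z + i q] is close to [t/2] times a unitary. *)
Lemma sn_le_of_pos x t : 0 <= t -> sn_pos p x -> sn_pos p (sc t - x) -> p x <= t.
Proof.
move=> t0 xpos ypos; set y := sc t - x in ypos.
pose z := x - sc (t / 2).
have xy : x * y = sc (t ^+ 2 / 4) - z * z.
  have -> : t ^+ 2 / 4 = (t / 2) * (t / 2) by lra.
  have -> : y = sc (t / 2) + sc (t / 2) - x by rewrite /y -scD -splitr.
  have xT := scC (t / 2) x; rewrite (scM (t / 2) (t / 2)) /z; move: (sc (t / 2)) xT => T xT.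
  rewrite (_ : x * (T + T - x) = T * x + x * T - x * x); first by ncring.
  by rewrite xT; ncring.
have cxy : GRing.comm x y.
  by apply: commrB => //; rewrite /GRing.comm scC.
have zz : star z = z by rewrite starB star_sc (sn_pos_star xpos).
have cz w : GRing.comm x w -> GRing.comm z w.
  by move=> xw; apply/commr_sym/commrB; [exact/commr_sym|exact: comm_sc].
suff pz : p z <= t / 2.
  have -> : x = z + sc (t / 2) by rewrite subrK.
  have t20 : 0 <= t / 2 by rewrite divr_ge0.
  by apply: (le_trans (csnD hp _ _)); have := sn_sc_ge0 hp t20; lra.
rewrite -(@ler_pXn2r _ 2) ?nnegrE ?divr_ge0 ?(sn_ge0 hp)//.
apply: (@le_of_le_addM _ (p x + p y + 1)) => e e0 e1.
have [m [/sn_pos_star mm cm hm]] := sn_pos_sqrt xpos e0.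
have [n [/sn_pos_star nn cn hn]] := sn_pos_sqrt ypos e0.
(* Both roots commute because x commutes with y: n commutes with x, hence with m. So m n is
   self-adjoint with square m^2 n^2. *)
have mn : GRing.comm n m by apply: cm; apply/commr_sym/cn.
have qq : star (m * n) = m * n by rewrite starM mm nn.
have zq : GRing.comm z (m * n).
  by apply: commrM; apply: cz; [exact: cm|exact: cn].
apply: (le_trans (sn_unitary hp zz qq zq)).
(* As z^2 + x y = t^2/4, what remains is the error in m^2 n^2 ~ x y. *)
have -> : z * z + m * n * (m * n) =
    sc (t ^+ 2 / 4) + (m * m * (n * n - y) + (m * m - x) * y).
  have -> : z * z = sc (t ^+ 2 / 4) - x * y by rewrite xy; ncring.
  have -> : m * n * (m * n) = m * m * (n * n).
    by rewrite -mulrA (mulrA n) mn; ncring.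
  by ncring.
have pm : p (m * m) <= p x + e by have := sn_near hp (m * m) x; lra.
have t40 : 0 <= t ^+ 2 / 4 by rewrite divr_ge0 ?sqr_ge0.
have := sn_sc_ge0 hp t40.
have := csnD hp (sc (t ^+ 2 / 4)) (m * m * (n * n - y) + (m * m - x) * y).
have := csnD hp (m * m * (n * n - y)) ((m * m - x) * y).
have := csnM hp (m * m) (n * n - y).
have := csnM hp (m * m - x) y.
have h1 : p (m * m) * p (n * n - y) <= (p x + e) * e by apply: ler_pM; rewrite ?(sn_ge0 hp).
have h2 : p (m * m - x) * p y <= e * p y by apply: ler_wpM2r; rewrite ?(sn_ge0 hp).
have -> : (t / 2) ^+ 2 = t ^+ 2 / 4 by lra.
nra.
Qed.

Lemma sn_pos_mono x y : sn_pos p x -> sn_pos p (y - x) -> p x <= p y.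
Proof.
move=> xpos yx; have yy : star y = y.
  by rewrite -(subrK x y) starD (sn_pos_star yx) (sn_pos_star xpos).
apply: sn_le_of_pos => //; first exact: sn_ge0.
have -> : sc (p y) - x = (sc (p y) - y) + (y - x) by ncring.
apply: sn_posD => //; split; first by rewrite starB star_sc yy.
by exists (p y); rewrite ?(sn_ge0 hp)// opprB addrC subrK.
Qed.

Lemma sn_pos_near f g e : sn_pos p g -> star f = f -> p (f - g) <= e ->
  sn_pos p (f + sc e).
Proof.
move=> gpos ff fg; have -> : f + sc e = g + (f - g + sc e) by ncring.
apply: sn_posD => //; split.
  by rewrite starD starB star_sc ff (sn_pos_star gpos).
exists e; first by apply: le_trans fg; exact: sn_ge0.
by rewrite (_ : _ - _ = - (f - g)) ?(snN hp)//; ncring.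
Qed.

(** The witness s = p h + C serves all e <= 1 at once, so the inequality defining positivity passes
    to the limit. *)
Lemma sn_pos_lim C h : 0 <= C -> star h = h ->
  (forall e, 0 < e -> e <= 1 -> sn_pos p (h + sc (C * e))) -> sn_pos p h.
Proof.
move=> C0 hh H; split=> //; exists (p h + C); first by rewrite addr_ge0 ?(sn_ge0 hp).
apply: (@le_of_le_addM _ C) => e e0 e1.
have Ce : 0 <= C * e by apply: mulr_ge0 => //; exact: ltW.
have pCe := sn_sc_ge0 hp Ce.
have ph : p (h + sc (C * e)) <= p h + C.
  by apply: (le_trans (csnD hp _ _)); nra.
have := sn_pos_sub (H e e0 e1) ph.
have := csnD hp (sc (p h + C) - (h + sc (C * e))) (sc (C * e)).
rewrite (_ : _ - _ + _ = sc (p h + C) - h); last by ncring.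
by lra.
Qed.

(* With [m ~ sqrt (e - b^*b)] and [c = b m], both [c^*c] and [c c^*] are nearly
   negative, whereas their sum is a sum of two squares of self-adjoints. *)
Lemma sn_sq_le_of_pos b e : 0 <= e -> sn_pos p (sc e - star b * b) -> p b ^+ 2 <= 2 * e.
Proof.
move=> e0 bpos; set v := star b * b in bpos; pose u := b * star b.
have vv : star v = v by rewrite starM starK.
have uu : star u = u by rewrite starM starK.
apply: (@le_of_le_addM _ 2) => d d0 d1.
have [m [/sn_pos_star mm cm hm]] := sn_pos_sqrt bpos d0.
have mv : GRing.comm m v.
  apply/commr_sym/cm; apply: commrB; last exact: commr_refl.
  exact: comm_sc.
have pmv : p (m * m + v) <= e + d.
  have -> : m * m + v = (m * m - (sc e - v)) + sc e by ncring.
  by apply: (le_trans (csnD hp _ _)); have := sn_sc_ge0 hp e0; lra.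
pose c := b * m; set B := p b ^+ 2.
have pv : p v = B by rewrite (csn_star hp).
have cpos : sn_pos p (star c * c + c * star c).
  pose y := 'i%C *: (c - star c).
  have ys : star y = y.
    rewrite /y starZ starB starK -[c - _]opprB scalerN -scaleNr.
    by congr (_ *: _); apply/eqP; rewrite eq_complex /= oppr0 !eqxx.
  have xs : star (c + star c) = c + star c by rewrite starD starK addrC.
  have h20 : (0 : R) <= 2^-1 by rewrite invr_ge0.
  have := sn_posZ h20 (sn_posD (sn_pos_sq xs) (sn_pos_sq ys)).
  have -> // : (c + star c) * (c + star c) + y * y =
      sc 2 * (star c * c + c * star c).
    rewrite /y -scalerAl -scalerAr scalerA -(expr2 'i%C) sqr_i scaleN1r sc2.
    by ncring.
  by rewrite scKV ?pnatr_eq0.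
(* From m^2 ~ e - v one gets c^* c ~ e v - v^2 and c c^* ~ e u - u^2. Hence B^2 <= p(u^2 + v^2) <= 2
   (e + d) B, and B is cancelled at the end. *)
have near : p (- (u * u + v * v) - (star c * c + c * star c)) <= 2 * (e + d) * B.
  have -> : - (u * u + v * v) - (star c * c + c * star c) =
     - ((m * m + v) * v) - b * (m * m + v) * star b.
    rewrite /c !starM mm.
    have -> : m * star b * (b * m) = m * m * v.
      by rewrite -mulrA (mulrA (star b)) -/v -mv mulrA.
    by rewrite /u; rewrite /v; ncring.
  have := snB hp (- ((m * m + v) * v)) (b * (m * m + v) * star b).
  rewrite (snN hp).
  have := csnM hp (m * m + v) v.
  have := csnM hp (b * (m * m + v)) (star b).
  have := csnM hp b (m * m + v).
  rewrite (sn_star hp) pv.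
  have B0 : 0 <= B by exact: sqr_ge0.
  have h1 : p (m * m + v) * B <= (e + d) * B by exact: ler_wpM2r.
  move=> h2 h3 h4 h5.
  have h6 : p (b * (m * m + v)) * p b <= (p b * p (m * m + v)) * p b.
    by apply: ler_wpM2r; rewrite ?(sn_ge0 hp).
  have h7 : (p b * p (m * m + v)) * p b = p (m * m + v) * B by rewrite /B; ring.
  by lra.
have wpos : sn_pos p (u * u + v * v) by apply: sn_posD; exact: sn_pos_sq.
have B0 : 0 <= B by exact: sqr_ge0.
have ed0 : 0 <= 2 * (e + d) * B by apply: mulr_ge0 => //; lra.
have pw : p (u * u + v * v) <= 2 * (e + d) * B.
  apply: sn_le_of_pos => //; rewrite addrC.
  by apply: (sn_pos_near cpos) => //; rewrite starN (sn_pos_star wpos).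
have pvw : B ^+ 2 <= p (u * u + v * v).
  rewrite -pv -(sn_sq hp vv); apply: sn_pos_mono; first exact: sn_pos_sq.
  by rewrite addrK; exact: sn_pos_sq.
have [->|Bn0] := eqVneq B 0; first by lra.
have Bgt0 : 0 < B by rewrite lt0r Bn0.
rewrite -(ler_pM2r Bgt0); nra.
Qed.

(* With [m ~ |h|] for [h = a^*a] and [d = m - h], so that [d] is about twice the
   negative part of [h], the element [(a d)^* (a d)] is nearly [- m d^2]. *)
Lemma sn_pos_star_mul a : sn_pos p (star a * a).
Proof.
set h := star a * a; have hh : star h = h by rewrite starM starK.
pose K := 2 * p h + 1; pose F := K + K ^+ 2.
have ph0 : 0 <= p h := sn_ge0 hp h.
have K1 : 1 <= K by rewrite /K; lra.
have F1 : 2 <= F by rewrite /F; nra.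
apply: (@sn_pos_lim 1) => // r r0 r1; rewrite mul1r.
(* K bounds p d, and the estimates below give p(d^3) <= 7 e F; so p(d)^4 <= 7 e K F, which this
   choice makes r^4. *)
pose e := r ^+ 4 / (7 * K * F).
have KF : 0 < 7 * K * F by rewrite !mulr_gt0//; lra.
have e0 : 0 < e by rewrite divr_gt0// exprn_gt0.
have eE : e * (7 * K * F) = r ^+ 4 by rewrite /e divfK// gt_eqF.
have e1 : e <= 1.
  rewrite ler_pdivrMr// mul1r.
  have : r ^+ 4 <= 1 by rewrite exprn_ile1// ltW.
  have : 1 <= K * F by nra.
  lra.
have [m [mpos cm hm]] := sn_pos_sqrt (sn_pos_sq hh) e0.
have mm := sn_pos_star mpos.
have chm : GRing.comm h m by apply: cm; exact: commrM.
pose d := m - h; have dd : star d = d by rewrite starB mm hh.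
have chd : GRing.comm h d by exact: commrB.
have cmd : GRing.comm m d by apply: commrB => //; exact: commr_sym.
have pm : p m <= p h + 1.
  rewrite -(@ler_pXn2r _ 2) ?nnegrE ?(sn_ge0 hp)//; last by lra.
  rewrite -(sn_sq hp mm).
  by have := sn_near hp (m * m) (h * h); rewrite (sn_sq hp hh); nra.
have pd : p d <= K.
  by apply: (le_trans (snB hp _ _)); rewrite /K; lra.
have pd0 : 0 <= p d := sn_ge0 hp d.
suff dr : p d <= r.
  by apply: (sn_pos_near mpos) => //; rewrite (sn_distC hp).
have [n [/sn_pos_star nn cn hn]] := sn_pos_sqrt mpos e0.
have cnd : GRing.comm n d by apply/commr_sym/cn/commr_sym.
have ndpos : sn_pos p (d * (n * n) * d).
  have -> : d * (n * n) * d = (n * d) * (n * d).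
    by rewrite mulrA -cnd -!mulrA.
  by apply: sn_pos_sq; rewrite starM nn dd.
have mE : m = d + h by rewrite subrK.
have dhd : d * h * d = h * d * d by rewrite chd.
clearbody d.
(* The left side is d h d, and d (m + h) = m^2 - h^2 is small. *)
have adE : star (a * d) * (a * d) = - (d * m * d) + (m * m - h * h) * d.
  transitivity (d * h * d); first by rewrite starM dd /h; ncring.
  by rewrite dhd mE; ncring.
have pn : p (d * (n * n) * d - d * m * d) <= e * K ^+ 2.
  have -> : d * (n * n) * d - d * m * d = d * (n * n - m) * d by ncring.
  have := csnM hp (d * (n * n - m)) d.
  have := csnM hp d (n * n - m).
  have : p (d * (n * n - m)) * p d <= (p d * p (n * n - m)) * p d.
    by apply: ler_wpM2r => //; exact: csnM.
  have : (p d * p (n * n - m)) * p d <= K * e * K.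
    apply: ler_pM => //; first by rewrite mulr_ge0 ?(sn_ge0 hp).
    by apply: ler_pM; rewrite ?(sn_ge0 hp).
  lra.
have pmh : p ((m * m - h * h) * d) <= e * K.
  by apply: (le_trans (csnM hp _ _)); apply: ler_pM; rewrite ?(sn_ge0 hp).
(* The element - (a d)^* (a d) is within e F of the square (n d)^2, where n ~ sqrt m. *)
have adneg : p (a * d) ^+ 2 <= 2 * (e * F).
  apply: sn_sq_le_of_pos; first by rewrite mulr_ge0 ?ltW//; lra.
  rewrite addrC; apply: (sn_pos_near ndpos); first by rewrite starN starM starK.
  have -> : - (star (a * d) * (a * d)) - d * (n * n) * d =
    - (d * (n * n) * d - d * m * d) - (m * m - h * h) * d.
    by rewrite adE; ncring.
  apply: (le_trans (snB hp _ _)); rewrite (snN hp) /F; lra.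
have pdmd : p (d * m * d) <= 3 * (e * F).
  have -> : d * m * d = (m * m - h * h) * d - star (a * d) * (a * d).
    by rewrite adE; ncring.
  apply: (le_trans (snB hp _ _)); rewrite (csn_star hp).
  have : e * K <= e * F by rewrite ler_pM2l// /F; have := sqr_ge0 K; lra.
  lra.
(* Writing the middle factor as d = m - h turns d^3 into d m d - d h d, where d h d ~ - d m d. *)
have pddd : p (d * d * d) <= 7 * (e * F).
  have -> : d * d * d = sc 2 * (d * m * d) - (m * m - h * h) * d.
    transitivity (d * d * d + d * h * d - h * d * d); first by rewrite dhd addrK.
    by rewrite sc2 mE; ncring.
  apply: (le_trans (snB hp _ _)); rewrite (sn_scM hp) ger0_norm//.
  have : e * K <= e * F by rewrite ler_pM2l// /F; have := sqr_ge0 K; lra.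
  lra.
have pdddd : p d ^+ 4 <= r ^+ 4.
  rewrite -eE (exprM _ 2 2) -(sn_sq hp dd).
  have dds : star (d * d) = d * d by rewrite starM dd.
  rewrite -(sn_sq hp dds).
  have -> : d * d * (d * d) = d * (d * d * d) by ncring.
  apply: (le_trans (csnM hp _ _)).
  have -> : e * (7 * K * F) = K * (7 * (e * F)) by ring.
  by apply: ler_pM; rewrite ?(sn_ge0 hp).
by rewrite -(@ler_pXn2r _ 4) ?nnegrE// ltW.
Qed.

(** With m ~ sqrt h, the element a^* h a is close to (m a)^* (m a). *)
Lemma sn_pos_conj a h : sn_pos p h -> sn_pos p (star a * h * a).
Proof.
move=> hpos; apply: (@sn_pos_lim (p a ^+ 2)); first exact: sqr_ge0.
  by rewrite !starM starK (sn_pos_star hpos) mulrA.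
move=> e e0 e1; have [m [/sn_pos_star mm _ hm]] := sn_pos_sqrt hpos e0.
apply: (sn_pos_near (sn_pos_star_mul (m * a))).
  by rewrite !starM starK (sn_pos_star hpos) mulrA.
rewrite starM mm (_ : _ - _ = star a * (h - m * m) * a); last by ncring.
apply: (le_trans (csnM hp _ _)); rewrite mulrC expr2 -mulrA.
apply: ler_wpM2l; first exact: sn_ge0.
apply: (le_trans (csnM hp _ _)); rewrite (sn_star hp) (sn_distC hp).
by apply: ler_wpM2l => //; exact: sn_ge0.
Qed.

End PositiveElements.

(** * Locally C*-algebras *)

Section LocallyCstarAlgebra.
Context {R : realType} {A : locallyCstarType R}.
Implicit Types (a b h x y : A) (p q : A -> R).

(** Keeps the family nonempty, as filter bases and suprema indexed by it require. *)
Lemma cstar_seminorms0 : @cstar_seminorms R A (fun=> 0).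
Proof.
split; last exact: cst_continuous.
by split=> *; rewrite ?addr0 ?mulr0 ?expr0n.
Qed.

(** Directedness of the family, which makes the sets of approximate inverses in [inverse1D] a filter
    base. *)
Lemma cstar_seminorms_max p q : cstar_seminorms p -> cstar_seminorms q ->
  cstar_seminorms (fun a => Num.max (p a) (q a)).
Proof.
move=> [hp cp] [hq cq]; split; last first.
  by move=> a; apply: (@continuous_max R A p q a); [exact: cp|exact: cq].
have pm a : p a <= Num.max (p a) (q a) by rewrite le_max lexx.
have qm a : q a <= Num.max (p a) (q a) by rewrite le_max lexx orbT.
split.
- by move=> a; rewrite le_max (csn_ge0 hp).
- move=> a b; rewrite ge_max; apply/andP; split.
    by apply: (le_trans (csnD hp a b)); exact: lerD.
  by apply: (le_trans (csnD hq a b)); exact: lerD.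
- move=> c a; rewrite (csnZ hp) (csnZ hq) maxr_pMr//.
  by rewrite normc_def /= sqrtr_ge0.
- move=> a b; rewrite ge_max; apply/andP; split.
    by apply: (le_trans (csnM hp a b)); apply: ler_pM; rewrite ?(csn_ge0 hp).
  by apply: (le_trans (csnM hq a b)); apply: ler_pM; rewrite ?(csn_ge0 hq).
- move=> a; rewrite (csn_star hp) (csn_star hq).
  have p0 := csn_ge0 hp a; have q0 := csn_ge0 hq a.
  by have [pq|pq] := leP (p a) (q a); [rewrite max_r|rewrite max_l];
     rewrite // ler_pXn2r// ltW.
Qed.

(** When all p vanish at a, the principal filter at a converges to 0, so a and 0 cannot be
    separated. *)
Lemma lc_eq0 a : (forall p, cstar_seminorms p -> p a = 0) -> a = 0.
Proof.
move=> pa0; apply: (@lc_hausdorff R A) => U V Ua V0; exists a.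
split; first exact: nbhs_singleton.
suff /(_ V V0) : globally [set a] --> (0 : A) by apply.
have PF : ProperFilter (globally [set a]) by exact: globally_properfilter.
apply/lc_topology => p hp W W0 x -> /=; rewrite (pa0 p hp).
exact: nbhs_singleton W0.
Qed.

Lemma cvg_cstar_seminorms (F : set_system A) (l : A) : ProperFilter F ->
  sn_cvg (@cstar_seminorms R A) F l -> F --> l.
Proof.
move=> PF Fl.
have H : (fun x => x - l) @ F --> (0 : A) by apply/lc_topology.
have cl : {for 0, continuous (fun y : A => y + l)}.
  apply: (@continuous_comp A (A * A)%type A (fun y => (y, l)) (fun z => z.1 + z.2)).
    by apply: cvg_pair; [exact: cvg_id|exact: cvg_cst].
  exact: add_continuous.
have := cvg_comp _ _ H cl; rewrite add0r.
rewrite (_ : _ @ _ = F)//; apply/funext => U; rewrite /fmap /=.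
by congr F; apply/funext => x /=; rewrite subrK.
Qed.

Lemma sn_cvgP (V : zmodType) (P : set (V -> R)) (F : set_system V) (l : V) :
  ProperFilter F -> (forall r, P r -> forall v, 0 <= r v) ->
  sn_cvg P F l <-> (forall r, P r -> forall e, 0 < e -> \forall v \near F, r (v - l) <= e).
Proof.
move=> PF P0; split=> H r Pr.
  move=> e e0; have /cvgr0Pnorm_le /(_ e e0) := H r Pr.
  by apply: filterS => x; rewrite ger0_norm// P0.
apply/cvgr0Pnorm_le => e e0; have := H r Pr e e0.
by apply: filterS => x; rewrite ger0_norm// P0.
Qed.

Lemma cstar_seminorms_ge0 p : cstar_seminorms p -> forall a, 0 <= p a.
Proof. by move=> [hp _]; exact: csn_ge0. Qed.

(** A truncated Neumann series: 1 + h = s (1 - k) with s = 1 + p h and k = (p h - h) / s, where p k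
    <= p h / s < 1. *)
Lemma approx_inverse1D h p e : cstar_seminorm p -> sn_pos p h -> 0 < e ->
  exists x, p ((1 + h) * x - 1) <= e.
Proof.
move=> hp hpos e0; pose s := 1 + p h.
have ph0 := sn_ge0 hp h.
have s0 : 0 < s by rewrite /s; lra.
pose k := sc s^-1 * (sc (p h) - h).
have kE : sc s * (1 - k) = 1 + h.
  by rewrite mulrBr scVK ?gt_eqF// mulr1 /s scD sc1; ncring.
have pk : p k < 1.
  rewrite (sn_scM hp) gtr0_norm ?invr_gt0// mulrC ltr_pdivrMr// mul1r.
  by apply: (le_lt_trans (sn_pos_sub hp hpos (lexx _))); rewrite /s; lra.
have [|//|n hn] := @expr_small _ (p k) e; first by rewrite (sn_ge0 hp).
exists (sc s^-1 * \sum_(i < n.+1) k ^+ i).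
have -> : (1 + h) * (sc s^-1 * \sum_(i < n.+1) k ^+ i) = 1 - k ^+ n.+1.
  rewrite -kE -mulrA (mulrA (1 - k)) -(scC _ (1 - k)) -mulrA scVK ?gt_eqF//.
  by rewrite -[1 - k]opprB mulNr -subrX1 opprB.
rewrite (_ : _ - _ = - k ^+ n.+1) ?(snN hp)//; last by ncring.
have pkn : p (k ^+ n.+1) <= p k ^+ n.+1.
  elim: n {hn} => [|n IH]; first by rewrite !expr1.
  rewrite !(exprS _ n.+1); apply: (le_trans (csnM hp _ _)).
  by apply: ler_wpM2l => //; exact: sn_ge0.
apply: (le_trans pkn); apply: (@le_trans _ _ (p k ^+ n)); last exact: ltW.
by rewrite exprS ler_piMl ?exprn_ge0 ?(sn_ge0 hp)// ltW.
Qed.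

(** Here (1 + h)^2 - 1 = 2 h + h^2 is positive, and so is its conjugate by x. *)
Lemma sn_le_mul1D h x p : cstar_seminorm p -> sn_pos p h ->
  p x <= p ((1 + h) * x).
Proof.
move=> hp hpos; have hh := sn_pos_star hpos.
rewrite -(@ler_pXn2r _ 2) ?nnegrE ?(sn_ge0 hp)// -!(csn_star hp).
apply: (sn_pos_mono hp); first exact: sn_pos_star_mul.
have -> : star ((1 + h) * x) * ((1 + h) * x) - star x * x =
    star x * (h + h + h * h) * x.
  by rewrite starM starD star1 hh; ncring.
apply: sn_pos_conj => //; apply: sn_posD => //; first exact: sn_posD.
exact: sn_pos_sq.
Qed.

(* The sets of approximate inverses for each seminorm generate a Cauchy filter,
   as [p (x - y) <= p ((1 + h) (x - y))]. *)
Lemma inverse1D h : (forall p, cstar_seminorms p -> sn_pos p h) ->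
  exists l : A, [/\ star l = l, (1 + h) * l = 1 & l * (1 + h) = 1].
Proof.
move=> hpos.
pose D := [set pe : (A -> R) * R | cstar_seminorms pe.1 /\ 0 < pe.2].
pose B (pe : (A -> R) * R) := [set x : A | pe.1 ((1 + h) * x - 1) <= pe.2].
pose F := filter_from D B.
have PF : ProperFilter F.
  apply: filter_from_proper; last first.
    move=> [p e] [/= [hp cp] e0].
    have [x hx] := approx_inverse1D hp (hpos p (conj hp cp)) e0.
    by exists x.
  apply: filter_from_filter.
    by exists (fun=> 0, 1); split=> //=; exact: cstar_seminorms0.
  move=> [p e] [q f] [/= Sp e0] [/= Sq f0].
  exists (fun a => Num.max (p a) (q a), Num.min e f) => /=.
    by split=> /=; [exact: cstar_seminorms_max|rewrite lt_min e0].
  move=> x; rewrite /B /= ge_max !le_min.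
  by move=> /andP[/andP[? _] /andP[_ ?]].
have Fnear p e : cstar_seminorms p -> 0 < e -> F [set x | p ((1 + h) * x - 1) <= e].
  by move=> Sp e0; exists (p, e).
have [l Fl] : exists l : A, F --> l.
  apply: lc_complete; apply/lc_topology => p Sp; have hp := Sp.1.
  apply/cvgr0Pnorm_le => e e0.
  have e20 : 0 < e / 2 by exact: divr_gt0.
  exists (B (p, e / 2), B (p, e / 2)); first by split; exact: Fnear.
  move=> [x y] [/= hx hy]; rewrite ger0_norm ?(sn_ge0 hp)//.
  apply: (le_trans (sn_le_mul1D (x - y) hp (hpos p Sp))).
  have -> : (1 + h) * (x - y) = ((1 + h) * x - 1) - ((1 + h) * y - 1) by ncring.
  apply: (le_trans (snB hp _ _)).
  by move: hx hy; rewrite /B /=; lra.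
have hl : (1 + h) * l = 1.
  apply/eqP; rewrite -subr_eq0; apply/eqP/lc_eq0 => p Sp; have hp := Sp.1.
  apply/eqP; rewrite eq_le (sn_ge0 hp) andbT.
  apply: (@le_of_le_addM _ (p (1 + h) + 1)) => e e0 _; rewrite add0r.
  have Fx : \forall x \near F, p (x - l) < e.
    have cpl : {for l, continuous (fun x : A => p (x - l))}.
      apply: (@continuous_comp A A R (fun x => x - l) p); last exact: Sp.2.
      apply: (@continuous_comp A (A * A)%type A (fun y => (y, - l)) (fun z => z.1 + z.2)).
        by apply: cvg_pair; [exact: cvg_id|exact: cvg_cst].
      exact: add_continuous.
    have := cvg_trans (cvg_app _ Fl) cpl; rewrite subrr (sn0 hp) => /cvgr0Pnorm_lt /(_ e e0).
    by apply: filterS => x; rewrite ger0_norm// (sn_ge0 hp).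
  have [x [/= hx1 hx2]] := filter_ex (filterI (Fnear p e Sp e0) Fx).
  have -> : (1 + h) * l - 1 = ((1 + h) * x - 1) - (1 + h) * (x - l) by ncring.
  have := snB hp ((1 + h) * x - 1) ((1 + h) * (x - l)).
  have := csnM hp (1 + h) (x - l).
  have : p (1 + h) * p (x - l) <= p (1 + h) * e.
    by apply: ler_wpM2l; [exact: sn_ge0|exact: ltW].
  by lra.
(* Self-adjointness of h is read off at the zero seminorm. The adjoint of l is then a left inverse,
   hence equal to the right inverse l. *)
have hh : star h = h by have [] := hpos _ cstar_seminorms0.
have lh : star l * (1 + h) = 1.
  by have := congr1 star hl; rewrite starM starD star1 hh.
have ll : star l = l by rewrite -[LHS]mulr1 -[X in _ * X]hl mulrA lh mul1r.
by exists l; split => //; rewrite -{1}ll.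
Qed.

End LocallyCstarAlgebra.

(** * Residuals of a sequence in a Hilbert module *)

Section PreHilbertModule.
Context {R : realType} {A : locallyCstarType R} {E : preHilbertModType A}.
Implicit Types (x y z : E) (a b : A) (p : A -> R).

Lemma innerDl x y z : inner (x + y) z = inner x z + inner y z :> A.
Proof. by rewrite -star_inner innerDr starD !star_inner. Qed.

Lemma innerNr x y : inner x (- y) = - inner x y :> A.
Proof. by rewrite -scaleN1r innerZr scaleN1r. Qed.

Lemma innerNl x y : inner (- x) y = - inner x y :> A.
Proof. by rewrite -star_inner innerNr starN star_inner. Qed.

Lemma innerBr x y z : inner x (y - z) = inner x y - inner x z :> A.
Proof. by rewrite innerDr innerNr. Qed.

Lemma innerBl x y z : inner (x - y) z = inner x z - inner y z :> A.
Proof. by rewrite innerDl innerNl. Qed.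

Lemma innerAl x y a : inner (ract x a) y = star a * inner x y :> A.
Proof. by rewrite -star_inner innerAr starM star_inner. Qed.

Lemma ractZ (c : R[i]) x : c *: x = ract x (c%:A : A).
Proof. by rewrite ractZr ract1. Qed.

Lemma ract0 x : ract x (0 : A) = 0.
Proof. by rewrite -(scale0r (1 : A)) -ractZ scale0r. Qed.

Lemma ractNl x a : ract (- x) a = - ract x a.
Proof. by rewrite -scaleN1r ractZl scaleN1r. Qed.

Lemma sn_pos_inner p x : cstar_seminorm p -> sn_pos p (inner x x : A).
Proof. by move=> hp; have [b ->] := inner_ge0 (A:=A) x; exact: sn_pos_star_mul. Qed.

End PreHilbertModule.

Section Residuals.
Context {R : realType} {A : locallyCstarType R} {E : preHilbertModType A}.
Variable eta : nat -> E.
Implicit Types (x y z : E) (a b : A) (p : A -> R) (n k : nat).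

(** The operator R_n of the introduction; [frame n] is xi_n, here spelled out as R_n eta_n, and
    [frame_coef x n] is a_n. *)
Fixpoint residual n x : E :=
  if n is n'.+1 then
    residual n' x - ract (residual n' (eta n')) (inner (residual n' (eta n')) x : A)
  else x.

Definition frame n := residual n (eta n).

Definition frame_coef x n : A := inner (frame n) x.

Lemma residualS n x :
  residual n.+1 x = residual n x - ract (frame n) (frame_coef x n).
Proof. by []. Qed.

Lemma residualD n x y : residual n (x + y) = residual n x + residual n y.
Proof.
by elim: n => [//|n IH] /=; rewrite IH innerDr ractDr opprD addrACA.
Qed.

Lemma residualA n x a : residual n (ract x a) = ract (residual n x) a.
Proof.
by elim: n => [//|n IH] /=; rewrite IH innerAr ractM ractDl ractNl.
Qed.

Lemma residualN n x : residual n (- x) = - residual n x.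
Proof.
rewrite -scaleN1r (ractZ (A:=A)) residualA -(ractZ (A:=A)).
by rewrite scaleN1r.
Qed.

Lemma residualB n x y : residual n (x - y) = residual n x - residual n y.
Proof. by rewrite residualD residualN. Qed.

Lemma inner_residual n x y : inner (residual n x) y = inner x (residual n y) :> A.
Proof.
elim: n x y => [//|n IH] x y; rewrite !residualS innerBl innerBr IH innerAl innerAr.
by rewrite /frame_coef star_inner.
Qed.

Definition residual_form n x : A := inner x (residual n x).

Lemma residual_formS n x : residual_form n.+1 x =
  residual_form n x - star (frame_coef x n) * frame_coef x n.
Proof. by rewrite /residual_form residualS innerBr innerAr star_inner. Qed.

Lemma square_sums_frame_coef n x :
  square_sums (frame_coef x) n = inner x x - residual_form n x.
Proof.
rewrite /square_sums /series /=; elim: n => [|n IH].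
  by rewrite big_nil /residual_form /= subrr.
by rewrite big_nat_recr //= IH residual_formS; ncring.
Qed.

Lemma residual_form_le p n x : cstar_seminorm p ->
  sn_pos p (inner x x - residual_form n x).
Proof.
move=> hp; elim: n => [|n IH].
  by rewrite /residual_form /= subrr -sc0; exact: sn_pos_sc.
rewrite residual_formS opprB addrCA addrC; apply: sn_posD => //.
exact: sn_pos_star_mul.
Qed.

Hypothesis eta_le1 :
  forall p n, cstar_seminorm p -> sn_pos p (1 - inner (eta n) (eta n) : A).

(** Completing the square: with g = <xi_n, x> and c = <eta_n, R_n eta_n> <= 1, the new form at x is
    the old form at x - eta_n g plus g^* (1 - c) g. *)
Lemma residual_form_ge0 p n x : cstar_seminorm p -> sn_pos p (residual_form n x).
Proof.
move=> hp; elim: n x => [|n IH] x; first exact: sn_pos_inner.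
rewrite residual_formS; set g := frame_coef x n.
pose c := residual_form n (eta n).
have cpos : sn_pos p (1 - c).
  rewrite (_ : 1 - c = (1 - inner (eta n) (eta n)) + (inner (eta n) (eta n) - c)).
    by apply: sn_posD => //; [exact: eta_le1|exact: residual_form_le].
  by ncring.
have -> : residual_form n x - star g * g =
    residual_form n (x - ract (eta n) g) + star g * (1 - c) * g.
  rewrite /residual_form residualB residualA innerBl !innerBr !innerAr !innerAl.
  have -> : inner (eta n) (residual n x) = g by rewrite -inner_residual.
  have -> : inner x (residual n (eta n)) = star g by rewrite star_inner.
  rewrite -/(residual_form n (eta n)) -/c; ncring.
by apply: sn_posD => //; exact: sn_pos_conj.
Qed.

Lemma sn_residual_form_le p n x : cstar_seminorm p ->
  p (residual_form n x) <= p (inner x x).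
Proof.
move=> hp; apply: sn_pos_mono => //; first exact: residual_form_ge0.
exact: residual_form_le.
Qed.

(* [T - T^2 = T (1 - T) T + (1 - T) T (1 - T)] for the residual operator [T]. *)
Lemma sn_residual_le_form p n x : cstar_seminorm p ->
  p (inner (residual n x) (residual n x)) <= p (residual_form n x).
Proof.
move=> hp; apply: sn_pos_mono => //; first exact: sn_pos_inner.
set y := residual n x.
have -> : residual_form n x - inner y y =
    (inner y y - residual_form n y) + residual_form n (x - y).
  rewrite /residual_form residualB innerBl !innerBr -/y.
  have -> : inner x (residual n y) = inner y y by rewrite -inner_residual.
  by ncring.
apply: sn_posD => //; [exact: residual_form_le|exact: residual_form_ge0].
Qed.

Lemma frame_le1 p n : cstar_seminorm p -> p (inner (frame n) (frame n)) <= 1.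
Proof.
move=> hp; apply: (le_trans (sn_residual_le_form _ _ hp)).
apply: (le_trans (sn_residual_form_le _ _ hp)).
by apply: (sn_le_of_pos hp) => //; [exact: sn_pos_inner|rewrite sc1; exact: eta_le1].
Qed.

Lemma residual_form_visit p n k x : cstar_seminorm p -> x = eta n -> (0 < k)%N ->
  sn_pos p (sc k%:R^-1 - residual_form n x) ->
  sn_pos p (sc k.+1%:R^-1 - residual_form n.+1 x).
Proof.
move=> hp xE k0; rewrite residual_formS; set c := residual_form n x => cpos.
have cc : star c = c := sn_pos_star (residual_form_ge0 n x hp).
have -> : frame_coef x n = c.
  by rewrite /frame_coef /frame -xE inner_residual.
(* The map t - t^2 is increasing only up to 1/2, so k = 1 is separate: there c - c^2 = 1/4 - (c -
   1/2)^2. *)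
rewrite cc; have [k1|k2] := leqP k 1.
  have -> : k = 1%N by apply/eqP; rewrite eqn_leq k1.
  have hE : (2 : R)^-1 + 2^-1 = 1 by field.
  have qE : (2 : R)^-1 * 2^-1 = 4^-1 by field.
  have q1 : (2 : R)^-1 = 4^-1 + 4^-1 by field.
  have -> : sc 2^-1 - (c - c * c) =
      (c - sc 2^-1) * (c - sc 2^-1) + sc (4^-1) :> A.
    have cT := scC (2^-1) c.
    have cE : c = sc 2^-1 * c + c * sc 2^-1 by rewrite -cT -mulrDl -scD hE sc1 mul1r.
    have TT : sc 2^-1 * sc 2^-1 = sc 4^-1 :> A by rewrite -scM qE.
    have T2 : sc 2^-1 = sc 4^-1 + sc 4^-1 :> A by rewrite -scD -q1.
    rewrite mulrBl !mulrBr TT {1}T2 {1}cE; ncring.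
  apply: sn_posD => //; last by apply: sn_pos_sc => //; rewrite invr_ge0.
  by apply: sn_pos_sq => //; rewrite starB star_sc cc.
(* In terms of u the target is s + (1 - 2/k) u + u^2 with s = 1 / (k^2 (k + 1)), and k >= 2 makes
   each term positive. *)
pose u := sc k%:R^-1 - c; rewrite -/u in cpos.
have uu := sn_pos_star cpos.
have kR : 2 <= k%:R :> R by rewrite ler_nat.
pose s := k%:R^-1 ^+ 2 - k%:R^-1 + k.+1%:R^-1 : R.
have s0 : 0 <= s.
  have k10 : 0 < k%:R + 1 :> R by lra.
  have -> : s = (k%:R ^+ 2 * (k%:R + 1))^-1.
    by rewrite /s -natr1; field; rewrite ?gt_eqF//; lra.
  by rewrite invr_ge0 mulr_ge0 ?sqr_ge0// ltW.
have t0 : 0 <= 1 - 2 * k%:R^-1 :> R.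
  by rewrite subr_ge0 ler_pdivrMr ?mul1r//; lra.
have -> : sc k.+1%:R^-1 - (c - c * c) = sc s + sc (1 - 2 * k%:R^-1) * u + u * u.
  have -> : c = sc k%:R^-1 - u by rewrite /u opprB addrC subrK.
  have -> : sc s = sc k%:R^-1 * sc k%:R^-1 - sc k%:R^-1 + sc k.+1%:R^-1 :> A.
    by rewrite /s expr2 scD scB scM.
  have -> : sc (1 - 2 * k%:R^-1) * u = u - (sc k%:R^-1 + sc k%:R^-1) * u.
    by rewrite scB sc1 scM sc2 mulrBl mul1r.
  move: (sc k.+1%:R^-1) (sc k%:R^-1) (scC k%:R^-1 u) => S T Tu.
  rewrite [(T + T) * u]mulrDl {2}Tu; ncring.
apply: sn_posD => //; last exact: sn_pos_sq.
by apply: sn_posD => //; [exact: sn_pos_sc|exact: sn_posZ].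
Qed.

(** The bound 1 holds before any visit; each visit to x improves 1/k to 1/(k + 1), and the form
    never increases in between. *)
Lemma residual_form_visits p x : cstar_seminorm p ->
  (forall N, exists2 n, (N <= n)%N & eta n = x) ->
  forall k, exists N, forall n, (N <= n)%N ->
    sn_pos p (sc k.+1%:R^-1 - residual_form n x).
Proof.
move=> hp visits.
have decr N (r : R) : sn_pos p (sc r - residual_form N x) ->
    forall n, (N <= n)%N -> sn_pos p (sc r - residual_form n x).
  move=> HN n /subnK <-; elim: (n - N)%N => [//|m IH].
  rewrite addSn residual_formS opprB addrCA addrC.
  by apply: sn_posD => //; exact: sn_pos_star_mul.
elim=> [|k [N HN]].
  exists 0%N; apply: decr; have [n _ <-] := visits 0%N.
  by rewrite invr1 sc1; exact: eta_le1.
have [n Nn xE] := visits N; exists n.+1; apply: decr.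
by apply: residual_form_visit => //; exact: HN.
Qed.

Lemma residual_form_eta_cvg p x : cstar_seminorm p ->
  (forall N, exists2 n, (N <= n)%N & eta n = x) ->
  forall e, 0 < e -> exists N, forall n, (N <= n)%N -> p (residual_form n x) <= e.
Proof.
move=> hp visits e e0; have [k ke] : exists k, (k.+1%:R)^-1 < e.
  by have [k] := ltr_add_invr e0; rewrite add0r; exists k.
have [N HN] := residual_form_visits hp visits k; exists N => n Nn.
apply: (le_trans _ (ltW ke)); apply: (sn_le_of_pos hp).
- by rewrite invr_ge0.
- exact: residual_form_ge0.
- exact: HN.
Qed.

(** The difference of the two sides, before p is applied, is the form at x - y. *)
Lemma residual_form_parallelogram p n x y : cstar_seminorm p ->
  p (residual_form n (x + y)) <= 2 * p (residual_form n x) + 2 * p (residual_form n y).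
Proof.
move=> hp; apply: (@le_trans _ _ (p (sc 2 * residual_form n x + sc 2 * residual_form n y))).
  apply: sn_pos_mono => //; first exact: residual_form_ge0.
  have -> : sc 2 * residual_form n x + sc 2 * residual_form n y
      - residual_form n (x + y) = residual_form n (x - y).
    rewrite !sc2 /residual_form residualB residualD.
    rewrite !innerDr !innerDl !innerNr !innerNl.
    by match goal with |- ?u = ?v => change (u = v :> A) end; ncring.
  exact: residual_form_ge0.
by apply: (le_trans (csnD hp _ _)); rewrite !(sn_scM hp) ger0_norm.
Qed.

Lemma residual_formA n x a : residual_form n (ract x a) = star a * residual_form n x * a.
Proof. by rewrite /residual_form residualA innerAl innerAr mulrA. Qed.

Definition residual_null : set E :=
  [set x | forall p, cstar_seminorms p -> forall e, 0 < e ->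
     exists N, forall n, (N <= n)%N -> p (residual_form n x) <= e].

Lemma residual_null_submodule :
  closed_submodule [set: A] [set: E] (@module_seminorms R A E) residual_null.
Proof.
have MA x a : residual_null x -> residual_null (ract x a).
  move=> Mx p Sp e e0; have hp := Sp.1; have pa0 := sn_ge0 hp a.
  have e'0 : 0 < e / (p a ^+ 2 + 1) by rewrite divr_gt0// ltr_wpDl ?sqr_ge0.
  have [N HN] := Mx p Sp _ e'0; exists N => n /HN; rewrite residual_formA.
  rewrite ler_pdivlMr ?ltr_wpDl ?sqr_ge0// => H.
  have := csnM hp (star a * residual_form n x) a.
  have := csnM hp (star a) (residual_form n x).
  have := sn_ge0 hp (residual_form n x).
  rewrite (sn_star hp); nra.
split=> //.
- by rewrite -(ract0 0); apply: MA => p Sp e e0; exists 0%N => n _;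
     rewrite -(ract0 0) residual_formA mulr0 (sn0 Sp.1) ltW.
- move=> x y Mx My p Sp e e0; have hp := Sp.1.
  have e40 : 0 < e / 4 by exact: divr_gt0.
  have [N HN] := Mx p Sp _ e40; have [N' HN'] := My p Sp _ e40.
  exists (maxn N N') => n; rewrite geq_max => /andP[/HN h1 /HN' h2].
  by apply: (le_trans (residual_form_parallelogram _ _ _ hp)); lra.
- by move=> c x Mx; rewrite (ractZ (A:=A)); exact: MA.
- by move=> x a Mx _; exact: MA.
(* The form at x - y is at most <x - y, x - y> for every n, so a single y close to x suffices. *)
- move=> F PF FM x _ Fx p Sp e e0; have hp := Sp.1.
  have e40 : 0 < e / 4 by exact: divr_gt0.
  have Pp : module_seminorms (fun x : E => Num.sqrt (p (inner x x))) by exists p.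
  have s0 : 0 < Num.sqrt (e / 4) by rewrite sqrtr_gt0.
  have P0 : forall r, @module_seminorms R A E r -> forall v, 0 <= r v.
    by move=> _ [q _ <-] y; exact: sqrtr_ge0.
  have Fx' := (sn_cvgP x PF P0).1 Fx _ Pp _ s0.
  have [y [/= My]] := filter_ex (filterI FM Fx').
  rewrite ler_psqrt ?nnegrE ?(sn_ge0 hp) ?(ltW e40)// => yx.
  have [N HN] := My p Sp _ e40; exists N => n /HN h.
  rewrite -(subrK y x) addrC.
  apply: (le_trans (residual_form_parallelogram _ _ _ hp)).
  have := sn_residual_form_le n (y - x) hp.
  have -> : residual_form n (x - y) = residual_form n (y - x).
    by rewrite -opprB /residual_form residualN innerNl innerNr opprK.
  lra.
Qed.

End Residuals.

(** * Bounded elements *)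

Section SupSeminorm.
Context {R : realType} {V : zmodType} (P : set (V -> R)).
Hypothesis P0 : exists2 r, P r & forall v, r v = 0.

Lemma le_sn_sup v r : sn_bounded P v -> P r -> r v <= sn_sup P v.
Proof. by move=> bv Pr; apply: ub_le_sup => //; exists r. Qed.

Lemma sn_sup_le v c : (forall r, P r -> r v <= c) -> sn_sup P v <= c.
Proof.
move=> H; apply: ge_sup; first by have [r Pr _] := P0; exists (r v), r.
by move=> _ [r Pr <-]; exact: H.
Qed.

Lemma sn_sup_ge0 v : 0 <= sn_sup P v.
Proof.
have [bv|bv] := pselect (sn_bounded P v).
  by have [r Pr r0] := P0; rewrite -(r0 v); exact: le_sn_sup.
(* On an unbounded element [sup] takes its default value 0. *)
by rewrite /sn_sup sup_out// => -[].
Qed.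

End SupSeminorm.

Section BoundedPart.
Context {R : realType} {A : locallyCstarType R}.
Implicit Types (a b : A) (p : A -> R).

Lemma bA_le a (c : R) : (forall p, cstar_seminorms p -> p a <= c) -> bA A a.
Proof. by move=> H; exists c => _ [p Sp <-]; exact: H. Qed.

Lemma bA_bound a : bA A a -> exists c : R, forall p, cstar_seminorms p -> p a <= c.
Proof. by move=> [c H]; exists c => p Sp; apply: H; exists p. Qed.

Lemma bE_le (E : hilbertModType A) (x : E) (c : R) :
  (forall p, cstar_seminorms p -> p (inner x x) <= c) -> bE E x.
Proof.
move=> H; exists (Num.sqrt c) => _ [_ [p Sp <-] <-].
by apply: ler_wsqrtr; exact: H.
Qed.

Lemma bE_bound (E : hilbertModType A) (x : E) : bE E x ->
  exists c : R, forall p, cstar_seminorms p -> p (inner x x) <= c.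
Proof.
move=> [c H]; exists (c ^+ 2) => p Sp; have p0 := sn_ge0 Sp.1 (inner x x).
have xc : Num.sqrt (p (inner x x)) <= c.
  by apply: H; exists (fun x : E => Num.sqrt (p (inner x x))) => //; exists p.
rewrite -(sqr_sqrtr p0) ler_pXn2r ?nnegrE ?sqrtr_ge0//.
by apply: le_trans xc; exact: sqrtr_ge0.
Qed.

Lemma module_seminorms_zero (E : hilbertModType A) :
  exists2 r, @module_seminorms R A E r & forall v, r v = 0.
Proof.
exists (fun x : E => Num.sqrt 0); last by move=> _; exact: sqrtr0.
by exists (fun=> 0) => //; exact: cstar_seminorms0.
Qed.

Lemma bE_closed_submodule (E : hilbertModType A) :
  closed_submodule (bA A) (bE E) [set bE_norm E] (bE E).
Proof.
have bEA (x : E) a : bE E x -> bA A a -> bE E (ract x a).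
  move=> /bE_bound[c Hc] /bA_bound[d Hd]; apply: (@bE_le _ _ (d * c * d)) => p Sp.
  have hp := Sp.1; rewrite innerAl innerAr mulrA.
  apply: (le_trans (csnM hp _ _)); apply: ler_pM; rewrite ?(sn_ge0 hp)//; last exact: Hd.
  apply: (le_trans (csnM hp _ _)); rewrite (sn_star hp).
  by apply: ler_pM; rewrite ?(sn_ge0 hp)//; [exact: Hd|exact: Hc].
have bAc (c : R[i]) : bA A c%:A.
  apply: (@bA_le _ (complex.Re `|c|)) => p Sp; rewrite (csnZ Sp.1).
  by rewrite ler_piMr ?(sn1 Sp.1)// normc_def /= sqrtr_ge0.
split=> //.
- apply: (@bE_le _ _ 0) => p Sp.
  by rewrite -(ract0 (0 : E)) innerAr mulr0 (sn0 Sp.1).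
- move=> x y /bE_bound[c Hc] /bE_bound[d Hd].
  apply: (@bE_le _ _ (2 * c + 2 * d)) => p Sp.
  (* For n = 0 the residual form is the inner square, so the constant sequence 0 gives the
     parallelogram bound for <x + y, x + y>. *)
  have eta1 q (n : nat) : cstar_seminorm q ->
      sn_pos q (1 - inner (0 : E) (0 : E) : A).
    move=> hq; rewrite -(ract0 (0 : E)) innerAr mulr0 subr0 -sc1.
    exact: sn_pos_sc.
  have := @residual_form_parallelogram _ _ _ (fun=> 0) eta1 p 0 x y Sp.1.
  by rewrite /residual_form /=; have := Hc p Sp; have := Hd p Sp; lra.
- by move=> c x bx; rewrite (ractZ (A:=A)); exact: bEA.
Qed.

End BoundedPart.

(** * Contractive generators, each visited infinitely often *)

Section Normalization.
Context {R : realType} {A : locallyCstarType R} {E : preHilbertModType A}.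

(** For l = (1 + h)^{-1} and u = g l, one has 1 - <u, u> = l ((1 + h)^2 - h) l = l (1 + h + h^2) l,
    and g = u (1 + h). *)
Lemma exists_contraction (g : E) : exists u : E,
  (forall p, cstar_seminorm p -> sn_pos p (1 - inner u u : A)) /\
  exists a : A, g = ract u a.
Proof.
pose h : A := inner g g.
have hpos p : cstar_seminorm p -> sn_pos p h by move=> hp; exact: sn_pos_inner.
have [|l [ll hl lh]] := @inverse1D _ _ h; first by move=> p [hp _]; exact: hpos.
exists (ract g l); split; last by exists (1 + h); rewrite -ractM lh ract1.
move=> p hp; rewrite innerAl innerAr ll -/h.
have -> : 1 - l * (h * l) = star l * (1 + h + h * h) * l.
  have -> : 1 - l * (h * l) = (l * (1 + h)) * ((1 + h) * l) - l * (h * l).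
    by rewrite hl lh mulr1.
  by rewrite ll; ncring.
apply: sn_pos_conj => //; apply: sn_posD => //; last first.
  by apply: sn_pos_sq => //; exact: sn_pos_star (hpos p hp).
by apply: sn_posD => //; [rewrite -sc1; exact: sn_pos_sc|exact: hpos].
Qed.

(** The witness is n + 1 = 2^i (2 N + 1), of 2-adic valuation i. *)
Lemma logn2_visits (i N : nat) : exists2 n, (N <= n)%N & logn 2 n.+1 = i.
Proof.
exists (2 ^ i * N.*2.+1).-1.
  rewrite -ltnS prednK ?muln_gt0 ?expn_gt0//.
  by rewrite (leq_trans _ (leq_pmull _ _)) ?expn_gt0// ltnS -addnn leq_addr.
rewrite prednK ?muln_gt0 ?expn_gt0// lognM ?expn_gt0// pfactorK//.
by rewrite logn_coprime ?addn0// coprime2n /= odd_double.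
Qed.

Lemma exists_visiting_sequence (G : set E) : countable G -> exists eta : nat -> E,
  (forall p n, cstar_seminorm p -> sn_pos p (1 - inner (eta n) (eta n) : A)) /\
  forall g, G g -> exists u (a : A), g = ract u a /\
    forall N, exists2 n, (N <= n)%N & eta n = u.
Proof.
move=> /countable_injP[f finj].
pose P i (u : E) :=
  (forall p, cstar_seminorm p -> sn_pos p (1 - inner u u : A)) /\
  forall g, G g -> f g = i -> exists a : A, g = ract u a.
have Pex i : exists u, P i u.
  have [[g [Gg fg]]|no] := pselect (exists g, G g /\ f g = i).
    have [u [hu ga]] := exists_contraction g; exists u; split=> // g' Gg' fg'.
    suff -> : g' = g by [].
    by apply: finj; rewrite ?inE// fg.
  (* Indices that no generator takes are filled with a default contraction. *)
  have [u [hu _]] := exists_contraction 0; exists u; split=> // g Gg fg.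
  by case: no; exists g.
have [u Pu] := choice Pex.
exists (fun n => u (logn 2 n.+1)); split; first by move=> p n; exact: (Pu _).1.
move=> g Gg; have [a ga] := (Pu (f g)).2 g Gg erefl.
exists (u (f g)), a; split=> // N.
by have [n Nn nE] := logn2_visits (f g) N; exists n => //; rewrite nE.
Qed.

End Normalization.

(** * Norm convergence of the frame expansion in b(E) *)

Section StandardFrame.
Context {R : realType} {A : locallyCstarType R} {E : hilbertModType A}.
Hypothesis hA : b_standard_module A = standard_module_b A.
Variable eta : nat -> E.
Hypothesis eta_le1 :
  forall p n, cstar_seminorm p -> sn_pos p (1 - inner (eta n) (eta n) : A).

Lemma frame_coef_bounded (x : E) : residual_null eta x -> bE E x ->
  (forall n, bA A (frame_coef eta x n)) /\
  forall e : R, 0 < e -> exists N, forall n, (N <= n)%N ->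
    forall p, cstar_seminorms p -> p (residual_form eta n x : A) <= e.
Proof.
move=> Mx /bE_bound[c Hc].
pose l : A := inner x x; pose S := square_sums (frame_coef eta x).
have SE n : S n - l = - residual_form eta n x.
  by rewrite /S square_sums_frame_coef; rewrite /l; ncring.
have bl : bA A l by exact: (bA_le Hc).
have rc p n : cstar_seminorms p -> p (residual_form eta n x) <= c.
  move=> Sp; apply: (le_trans (sn_residual_form_le eta_le1 n x Sp.1)).
  exact: Hc.
have Sl : S @ \oo --> l.
  apply: cvg_cstar_seminorms; apply/sn_cvgP; first by move=> p Sp; exact: cstar_seminorms_ge0.
  move=> p Sp e e0; have [N HN] := Mx p Sp e e0.
  exists N => // n Nn; rewrite /= SE (snN Sp.1); exact: HN.
(* The equality of b(H_A) and H_{b(A)} enters here: it turns convergence in A to a bounded limit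
   into norm convergence. *)
have : standard_module_b A (frame_coef eta x) by rewrite -hA; exists l.
move=> [ba [l' bl' Sl']]; split=> // e e0.
have {}Sl' (d : R) : 0 < d -> exists N, forall n, (N <= n)%N ->
    forall p, cstar_seminorms p -> p (S n - l') <= d.
  move=> d0; have /cvgr0Pnorm_le /(_ d d0) [N _ HN] := Sl' _ erefl.
  exists N => n Nn p Sp; have hp := Sp.1.
  apply: (@le_trans _ _ (bA_norm A (S n - l'))); last first.
    by apply: le_trans (HN n Nn); exact: ler_norm.
  (* [bA_norm] dominates each seminorm only on bounded elements, so S n - l' is bounded first. *)
  apply: le_sn_sup => //; have [c' Hc'] := bA_bound bl'.
  apply: (@bA_le _ _ _ (c + c + c')) => q Sq; have hq := Sq.1.
  have -> : S n - l' = (S n - l) + l - l' by ncring.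
  apply: (le_trans (snB hq _ _)); apply: lerD; last exact: Hc'.
  apply: (le_trans (csnD hq _ _)); apply: lerD; last exact: Hc.
  by rewrite SE (snN hq); exact: rc.
(* Norm convergence implies convergence in each p, and the seminorms separate points. *)
have ll' : l = l'.
  apply/eqP; rewrite -subr_eq0; apply/eqP/lc_eq0 => p Sp; have hp := Sp.1.
  apply/eqP; rewrite eq_le (sn_ge0 hp) andbT.
  apply: (@le_of_le_addM _ 2) => d d0 _; rewrite add0r.
  have [N HN] := Sl' d d0; have [N' HN'] := Mx p Sp d d0.
  pose n := maxn N N'.
  have -> : l - l' = (S n - l') - (S n - l) by ncring.
  apply: (le_trans (snB hp _ _)); rewrite SE (snN hp).
  have := HN n (leq_maxl _ _) p Sp; have := HN' n (leq_maxr _ _); lra.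
have [N HN] := Sl' e e0; exists N => n Nn p Sp.
by have := HN n Nn p Sp; rewrite -ll' SE (snN Sp.1).
Qed.

Lemma frame_generating : (forall x : E, residual_null eta x) ->
  generating_set (bA A) (bE E) [set bE_norm E] (range (frame eta)).
Proof.
move=> Mall; have GbE : range (frame eta) `<=` bE E.
  by move=> _ [n _ <-]; apply: (@bE_le _ _ _ _ 1) => p Sp; exact: (frame_le1 eta_le1 n Sp.1).
split=> //; apply/seteqP; split.
  by apply: smallest_sub => //; exact: bE_closed_submodule.
move=> x bx M [/= Msub GM].
have [ba cvg0] := frame_coef_bounded (Mall x) bx.
(* x - R_n x is the partial sum of the xi_i a_i, with bounded coefficients a_i. *)
have Mn n : M (x - residual eta n x).
  elim: n => [|n IH]; first by rewrite /= subrr; exact: (csub0 Msub).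
  rewrite residualS opprB addrCA addrC; apply: (csubD Msub) => //.
  by apply: (csubA Msub) => //; apply: GM; exists n.
apply: (csub_closed Msub (F := (fun n => x - residual eta n x) @ \oo)) => //.
  by exists 0%N => // n _; exact: Mn.
apply/sn_cvgP.
  by move=> _ -> v; apply: sn_sup_ge0; exact: module_seminorms_zero.
(* The square is needed because the module norm is a square root, with p <R_n x, R_n x> <= p <x, R_n
   x>. *)
move=> _ -> e e0; have [N HN] := cvg0 (e ^+ 2) (exprn_gt0 _ e0).
exists N => // n Nn /=; apply: sn_sup_le; first exact: module_seminorms_zero.
move=> _ [p Sp <-] /=; rewrite addrC addKr innerNl innerNr opprK.
rewrite -(ger0_norm (ltW e0)) -sqrtr_sqr; apply: ler_wsqrtr.
apply: (le_trans (sn_residual_le_form eta_le1 n x Sp.1)).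
exact: HN.
Qed.

End StandardFrame.

Theorem corollary4p4 (R : realType) (A : locallyCstarType R)
    (hA : b_standard_module A = standard_module_b A)
    (E : hilbertModType A) :
  hilbert_countably_generated E -> bE_countably_generated E.
Proof.
move=> [G [Gc [_ GE]]].
have [eta [eta_le1 visits]] := exists_visiting_sequence Gc.
(* The elements with vanishing residual form are a closed submodule containing every generator g = u
   a, since u is visited infinitely often. *)
have Mall (x : E) : residual_null eta x.
  have : smallest (closed_submodule [set: A] [set: E] (@module_seminorms R A E)) G x.
    by rewrite GE.
  apply; split; first exact: (residual_null_submodule eta_le1).
  move=> g /visits[u [a [-> uvisits]]].
  apply: (csubA (residual_null_submodule eta_le1)) => //.
  by move=> p Sp e e0; exact: (residual_form_eta_cvg eta_le1 Sp.1 uvisits e0).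
exists (range (frame eta)); split; last exact: frame_generating.
exact: card_image_le.
Qed.
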